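(* Consider an arbitrary sequence of (possibly randomized) algorithms $\mathcal{A}_1,\ldots,\mathcal{A}_k$ with ranges $\mathcal{Y}_1,\ldots,\mathcal{Y}_k$ such that for all $i$, $\mathcal{A}_i:\mathcal{X}^n\times\mathcal{Y}_1\times\cdots\times\mathcal{Y}_{i-1}\to\mathcal{Y}_i$ is such that $\mathcal{A}_i(\cdot,y_1,\ldots,y_{i-1})$ has $\beta_i$-approximate max-information $k_i$ for all choices of $(y_1,\ldots,y_{i-1})\in\mathcal{Y}_1\times\cdots\times\mathcal{Y}_{i-1}$. Let the algorithm $\mathcal{B}:\mathcal{X}^n\to\mathcal{Y}_k$ be defined as follows: on input $S$, let $y_1=\mathcal{A}_1(S)$; for $i=2,\ldots,k$ let $y_i=\mathcal{A}_i(S,y_1,\ldots,y_{i-1})$; output $y_k$. Then $\mathcal{B}$ has $\left(\sum_i\beta_i\right)$-approximate max-information $\left(\sum_i k_i\right)$.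
   Context: All random variables take values in finite domains; $\log$ is the binary logarithm. The algorithms use independent internal randomness. For jointly distributed random variables $\boldsymbol{X},\boldsymbol{Y}$, $\boldsymbol{X}\times\boldsymbol{Y}$ denotes the random variable obtained by drawing $\boldsymbol{X}$ and $\boldsymbol{Y}$ independently from their marginal distributions. For random variables $\boldsymbol{U},\boldsymbol{V}$ over the same domain $\mathcal{D}$, $$D_\infty^\delta(\boldsymbol{U}\|\boldsymbol{V})=\log\max_{\mathcal{O}\subseteq\mathcal{D},\ \Pr[\boldsymbol{U}\in\mathcal{O}]>\delta}\frac{\Pr[\boldsymbol{U}\in\mathcal{O}]-\delta}{\Pr[\boldsymbol{V}\in\mathcal{O}]},$$ and $I_\infty^\beta(\boldsymbol{X};\boldsymbol{Y})=D_\infty^\beta((\boldsymbol{X},\boldsymbol{Y})\|\boldsymbol{X}\times\boldsymbol{Y})$. An algorithm $\mathcal{A}$ on $\mathcal{X}^n$ has $\beta$-approximate max-information $k$ if for every distribution $\mathcal{S}$ over $\mathcal{X}^n$ and $\boldsymbol{S}$ chosen randomly according to $\mathcal{S}$, $I_\infty^\beta(\boldsymbol{S};\mathcal{A}(\boldsymbol{S}))\le k$ (written $I_\infty^\beta(\mathcal{A},n)\le k$). *)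

(* Defs.v *)
From HB Require Import structures.
From mathcomp Require Import all_boot all_order all_algebra.
From mathcomp Require Import all_classical all_reals all_analysis.

Set Implicit Arguments.
Unset Strict Implicit.
Unset Printing Implicit Defensive.

Import Order.TTheory GRing.Theory Num.Theory.

Local Open Scope ring_scope.

Record fdist (R : realType) (T : finType) := FDist {
  fdist_pmf :> T -> R;
  fdist_ge0 : forall x, 0 <= fdist_pmf x;
  fdist_sum1 : \sum_x fdist_pmf x = 1 }.

Definition Pr (R : realType) (T : finType) (P : fdist R T) (O : {set T}) : R :=
  \sum_(x in O) P x.

Section Constructions.
Variable R : realType.

Fact fdist_ret_ge0 (T : finType) (a x : T) : 0 <= (x == a)%:R :> R.
Proof. exact: ler0n. Qed.

Fact fdist_ret_sum1 (T : finType) (a : T) : \sum_x (x == a)%:R = 1 :> R.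
Proof. by rewrite (bigD1 a) //= eqxx big1 ?addr0 // => x /negbTE ->. Qed.

Definition fdist_ret (T : finType) (a : T) : fdist R T :=
  FDist (fdist_ret_ge0 a) (fdist_ret_sum1 a).

Fact fdist_map_ge0 (T U : finType) (f : T -> U) (P : fdist R T) (u : U) :
  0 <= \sum_(x | f x == u) P x.
Proof. by apply: sumr_ge0 => x _; exact: fdist_ge0. Qed.

Fact fdist_map_sum1 (T U : finType) (f : T -> U) (P : fdist R T) :
  \sum_u \sum_(x | f x == u) P x = 1.
Proof. by rewrite -(fdist_sum1 P) (partition_big f xpredT). Qed.

(* The law of [f x] for [x] drawn from [P]. *)
Definition fdist_map (T U : finType) (f : T -> U) (P : fdist R T) : fdist R U :=
  FDist (fdist_map_ge0 f P) (fdist_map_sum1 f P).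

Fact fdist_joint_ge0 (T U : finType) (P : fdist R T) (W : T -> fdist R U)
  (z : T * U) : 0 <= P z.1 * W z.1 z.2.
Proof. by apply: mulr_ge0; exact: fdist_ge0. Qed.

Fact fdist_joint_sum1 (T U : finType) (P : fdist R T) (W : T -> fdist R U) :
  \sum_z P z.1 * W z.1 z.2 = 1.
Proof.
rewrite -(pair_bigA _ (fun x y => P x * W x y)) /= -(fdist_sum1 P).
by apply: eq_bigr => x _; rewrite -big_distrr /= fdist_sum1 mulr1.
Qed.

(* The law of the pair [(x, W(x))], where [x] is drawn from [P] and the
   randomized map [W] uses fresh internal randomness. *)
Definition fdist_joint (T U : finType) (P : fdist R T) (W : T -> fdist R U) :
    fdist R (T * U)%type :=
  FDist (fdist_joint_ge0 P W) (fdist_joint_sum1 P W).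

(* For the joint law [P] of (X, Y), the law of X x Y: independent draws from
   the two marginals. *)
Definition fdist_indep (T U : finType) (P : fdist R (T * U)%type) :
    fdist R (T * U)%type :=
  fdist_joint (fdist_map fst P) (fun=> fdist_map snd P).

End Constructions.

Section MaxInformation.
Variable R : realType.
Local Open Scope ereal_scope.

Definition log2 (x : \bar R) : \bar R := lne x / (ln 2)%:E.

(* Division is that of [\bar R], where [0^-1 = +oo]: the value is [+oo] as soon
   as an eligible event has probability zero under [V]. The maximum over no
   eligible event (possible only if [1 <= delta]) is [-oo], and
   [log2 -oo = -oo]. *)
Definition max_divergence (delta : R) (D : finType) (U V : fdist R D) :
    \bar R :=
  log2 (\big[maxe/-oo]_(O : {set D} | (delta < Pr U O)%R)
          ((Pr U O - delta)%:E / (Pr V O)%:E)).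

(* I_oo^beta(X; Y), as a function of the joint law of (X, Y). *)
Definition max_info (beta : R) (T U : finType) (P : fdist R (T * U)%type) :
    \bar R :=
  max_divergence beta P (fdist_indep P).

(* A randomized algorithm is a map from inputs to laws of outputs; here the
   datasets are the elements of [X]^n. *)
Definition has_approx_max_info (X Y : finType) (n : nat)
    (A : n.-tuple X -> fdist R Y) (beta k : R) : Prop :=
  forall S : fdist R (n.-tuple X), max_info beta (fdist_joint S A) <= k%:E.

End MaxInformation.

(* Y_0 x ... x Y_(i-1), associated to the left. *)
Fixpoint past_outputs (K : nat) (Y : 'I_K -> finType) (i : nat) :
    (i <= K)%N -> finType :=
  match i with
  | 0 => fun=> unit
  | j.+1 => fun ltjK => (past_outputs Y (ltnW ltjK) * Y (Ordinal ltjK))%type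
  end.

(* The i-th algorithm (counting from 0) reads the dataset and the outputs of
   all the previous ones. *)
Definition adaptive_algorithms (R : realType) (X : finType) (n K : nat)
    (Y : 'I_K -> finType) : Type :=
  forall (i : nat) (ltiK : (i < K)%N),
    n.-tuple X -> past_outputs Y (ltnW ltiK) -> fdist R (Y (Ordinal ltiK)).

(* The law of the outputs of the first [i] algorithms run on [S]. *)
Fixpoint transcript (R : realType) (X : finType) (n K : nat)
    (Y : 'I_K -> finType) (A : adaptive_algorithms R X n Y) (S : n.-tuple X)
    (i : nat) : forall leiK : (i <= K)%N, fdist R (past_outputs Y leiK) :=
  match i with
  | 0 => fun=> fdist_ret R tt
  | j.+1 => fun ltjK => fdist_joint (transcript A S (ltnW ltjK)) (A j ltjK S)
  end.

Definition adaptive_composition (R : realType) (X : finType) (n m : nat)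
    (Y : 'I_m.+1 -> finType) (A : adaptive_algorithms R X n Y)
    (S : n.-tuple X) : fdist R (Y ord_max) :=
  fdist_map snd (transcript A S (ltnSn m)).

(* Main.v *)
(* [max_divergence b U V <= k] holds iff E_U[h] <= b + 2^k E_V[h] for all
   h : D -> [0, 1]. Composing two such bounds naively would yield
   b2 + 2^k2 b1 + ..., since the bound 2^k2 f obtained for the second algorithm
   (conditionally on the first output) need not lie in [0, 1]. It may however be
   replaced with min(1, 2^k2 f), to which the bound for the first algorithm
   applies, and the total is b1 + b2 + 2^(k1 + k2) E_V[h]. By induction the
   whole transcript satisfies the summed bound, which is preserved by projecting
   onto the last output. *)
Require Import Defs.
From mathcomp Require Import all_boot all_order all_algebra.
From mathcomp Require Import all_classical all_reals all_analysis.
From mathcomp Require Import ring.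

Set Implicit Arguments.
Unset Strict Implicit.
Unset Printing Implicit Defensive.

Import Order.TTheory GRing.Theory Num.Theory.

Local Open Scope ring_scope.

Lemma log2_le (R : realType) (x : \bar R) (k : R) :
  (log2 x <= k%:E)%E = (x <= (2 `^ k)%:E)%E.
Proof.
have ln2_gt0 : 0 < ln 2 :> R by rewrite ln_gt0 // ltr1n.
have ln2E : ((ln (2 : R))%:E^-1 = (ln 2)^-1%:E)%E.
  by rewrite inver gt_eqF.
rewrite /log2 /= ln2E; case: x => [r| |] /=.
(* [lne] is -oo on nonpositive reals, where both inequalities hold. *)
- case: ifPn => [r_le0|]; last rewrite -ltNge => r_gt0.
    rewrite gt0_mulNye ?lte_fin ?invr_gt0 // leNye lee_fin.
    by rewrite (le_trans r_le0) ?powR_ge0.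
  rewrite -EFinM !lee_fin ler_pdivrMr //.
  by rewrite -ln_powR ler_ln ?posrE ?powR_gt0.
- by rewrite gt0_mulye ?lte_fin ?invr_gt0 // !leye_eq.
- by rewrite gt0_mulNye ?lte_fin ?invr_gt0 // !leNye.
Qed.

(** Events suffice as tests: E_U[h] - 2^k E_V[h] is linear in h, hence maximal over [0, 1]-valued h
    at the indicator of the event where 2^k V < U. *)
Lemma max_divergence_leP (R : realType) (D : finType) (U V : fdist R D)
    (b k : R) :
  (max_divergence b U V <= k%:E)%E <->
  forall h : D -> R, (forall x, 0 <= h x <= 1) ->
    \sum_x U x * h x <= b + 2 `^ k * \sum_x V x * h x.
Proof.
have PrE (W : fdist R D) O : Pr W O = \sum_x W x * (x \in O)%:R.
  by rewrite /Pr big_mkcond; apply: eq_bigr => x _; rewrite mulr_natr mulrb.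
have Pr_ge0 (W : fdist R D) O : 0 <= Pr W O.
  by apply: sumr_ge0 => x _; exact: fdist_ge0.
rewrite /max_divergence log2_le; split => [UV h h01|UV].
  have {}UV O : Pr U O <= b + 2 `^ k * Pr V O.
    have [bU|Ub] := ltP b (Pr U O); last first.
      by rewrite (le_trans Ub) // lerDl mulr_ge0 ?powR_ge0.
    have /(_ O bU) := (bigmax_leP _ _ _ _ UV).2.
    (* If [Pr V O] vanishes, the quotient is +oo, which the finite bound excludes. *)
    rewrite inver; case: eqP => [_|/eqP V0].
      by rewrite gt0_muley ?lte_fin ?subr_gt0 // leye_eq.
    have V_gt0 : 0 < Pr V O by rewrite lt_neqAle eq_sym V0 Pr_ge0.
    by rewrite -EFinM lee_fin ler_pdivrMr // lerBlDl.
  rewrite -lerBlDr mulr_sumr -sumrB.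
  pose O := [set x | 2 `^ k * V x < U x].
  apply: (@le_trans _ _ (\sum_(x in O) (U x - 2 `^ k * V x))); last first.
    by rewrite sumrB -mulr_sumr lerBlDr UV.
  rewrite [leRHS]big_mkcond; apply: ler_sum => x _.
  rewrite mulrA -mulrBl inE; have /andP[h0 h1] := h01 x.
  case: ltP => [lt|le]; first by rewrite ler_piMr // subr_ge0 ltW.
  by rewrite mulr_le0_ge0 // subr_le0.
apply/bigmax_leP; split => [|O bU]; first exact: leNye.
have {UV} : Pr U O <= b + 2 `^ k * Pr V O.
  by rewrite !PrE; apply: UV => x; case: (x \in O); rewrite ?ler01 ?lexx.
(* An eligible event has [b < Pr U O], which contradicts [le] if [Pr V O] is 0. *)
move=> le; have V_gt0 : 0 < Pr V O.
  rewrite lt_neqAle Pr_ge0 andbT; apply: contraTneq le => <-.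
  by rewrite mulr0 addr0 -ltNge.
by rewrite inver gt_eqF // -EFinM lee_fin ler_pdivrMr // lerBlDl.
Qed.

Section MaxInfo.
Variables (R : realType) (T : finType).

Definition output_law (U : finType) (P : fdist R T) (K : T -> fdist R U) :
  fdist R U := fdist_map snd (fdist_joint P K).

Lemma output_lawE (U : finType) (P : fdist R T) (K : T -> fdist R U) (u : U) :
  output_law P K u = \sum_x P x * K x u.
Proof.
rewrite /= (reindex_onto (fun x => (x, u)) fst) /=; last first.
  by move=> [x v] /= /eqP ->.
by apply: eq_bigl => x; rewrite !eqxx.
Qed.

Lemma fdist_joint_fst (U : finType) (P : fdist R T) (K : T -> fdist R U)
    (x : T) :
  fdist_map fst (fdist_joint P K) x = P x.
Proof.
rewrite /= -[RHS]mulr1 -(fdist_sum1 (K x)) mulr_sumr.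
rewrite (reindex_onto (fun u => (x, u)) snd) /=; last first.
  by move=> [y v] /= /eqP ->.
by apply: eq_bigl => u; rewrite !eqxx.
Qed.

(** The first marginal of the joint law is [P] itself, so both expectations become averages over [x]
    drawn from [P]. *)
Lemma max_info_leP (U : finType) (P : fdist R T) (K : T -> fdist R U)
    (b k : R) :
  (max_info b (fdist_joint P K) <= k%:E)%E <->
  forall h : T -> U -> R, (forall x u, 0 <= h x u <= 1) ->
    \sum_x P x * (\sum_u K x u * h x u) <=
    b + 2 `^ k * \sum_x P x * (\sum_u output_law P K u * h x u).
Proof.
have sumE (F : T -> U -> R) (h : T -> U -> R) :
    \sum_z P z.1 * F z.1 z.2 * h z.1 z.2 = \sum_x P x * (\sum_u F x u * h x u).
  rewrite -(pair_bigA _ (fun x u => P x * F x u * h x u)) /=.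
  apply: eq_bigr => x _; rewrite mulr_sumr.
  by apply: eq_bigr => u _; rewrite mulrA.
rewrite /max_info max_divergence_leP; split => H h h01.
  rewrite -(sumE K) -(sumE (fun=> output_law P K)).
  have := H (fun z => h z.1 z.2) (fun z => h01 z.1 z.2).
  congr (_ <= _ + _ * _); apply: eq_bigr => z _.
  by congr (_ * _ * _); exact: fdist_joint_fst.
pose g x u := h (x, u).
have hE z : h z = g z.1 z.2 by rewrite /g -surjective_pairing.
have := H g (fun x u => h01 (x, u)).
rewrite -(sumE K) -(sumE (fun=> output_law P K)).
congr (_ <= _ + _ * _); apply: eq_bigr => z _; rewrite hE //.
by congr (_ * _ * _); rewrite -[LHS](fdist_joint_fst P K).
Qed.

(* Used with [w x] the probability of the dataset [x] together with a given
   earlier output [u]: [r] is then the law of the new output given [u]. The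
   truncation at 1 is free, since the max-information bound need only be applied
   to the inputs [x] where the truncated expression is at most 1: elsewhere the
   inner sum on the left is at most 1. *)
Lemma max_info_truncated (U : finType) (K : T -> fdist R U) (b k : R)
    (w : T -> R) (h : T -> U -> R) (r : U -> R) :
  (forall P : fdist R T, (max_info b (fdist_joint P K) <= k%:E)%E) ->
  (forall x, 0 <= w x) -> (forall x u, 0 <= h x u <= 1) ->
  (forall u, r u * (\sum_x w x) = \sum_x w x * K x u) ->
  \sum_x w x * (\sum_u K x u * h x u) <=
  b * \sum_x w x +
    \sum_x w x * Num.min 1 (2 `^ k * \sum_u r u * h x u).
Proof.
move=> Kbk w_ge0 h01 rE; set W := \sum_x w x in rE *.
have W_ge0 : 0 <= W by exact: sumr_ge0.
have [W0|W_neq0] := eqVneq W 0.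
  have w0 x : w x = 0.
    by apply: (psumr_eq0P _ W0) => // y _; exact: w_ge0.
  by rewrite W0 mulr0 add0r; apply: ler_sum => x _; rewrite w0 !mul0r.
have W_gt0 : 0 < W by rewrite lt_neqAle eq_sym W_neq0.
have P_ge0 x : 0 <= w x / W by rewrite divr_ge0.
have P_sum1 : \sum_x w x / W = 1 by rewrite -mulr_suml divff.
(* Normalizing the weights amounts to conditioning the dataset on the earlier output. *)
pose P := FDist P_ge0 P_sum1.
have lawE u : output_law P K u = r u.
  rewrite output_lawE; apply: (mulIf W_neq0); rewrite rE mulr_suml.
  by apply: eq_bigr => x _ /=; rewrite mulrAC divfK.
pose G x := 2 `^ k * (\sum_u r u * h x u) <= 1.
(* Zeroing the test outside [G] keeps it in [0, 1], so the bound for [K] under [P] applies to it. *)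
pose hG x u := h x u *+ G x.
have hG01 x u : 0 <= hG x u <= 1.
  by rewrite /hG; case: (G x); rewrite ?mulr1n ?h01 // mulr0n lexx ler01.
have hGE (F : T -> U -> R) x :
    \sum_u F x u * hG x u = (\sum_u F x u * h x u) *+ G x.
  by rewrite -sumrMnl; apply: eq_bigr => u _; rewrite mulrnAr.
have /max_info_leP/(_ hG hG01) := Kbk P.
under eq_bigr => x _ do rewrite (hGE (fun x u => K x u)).
under [X in _ + _ * X]eq_bigr => x _.
  rewrite (hGE (fun _ u => output_law P K u)).
  under eq_bigr do rewrite lawE.
  over.
rewrite -(ler_pM2r W_gt0) mulrDl -mulrA !mulr_suml => le.
have {}le : \sum_x w x * ((\sum_u K x u * h x u) *+ G x) <=
    b * W + \sum_x w x * ((2 `^ k * \sum_u r u * h x u) *+ G x).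
  move: le; congr (_ <= _ + _); rewrite ?mulr_sumr;
    by apply: eq_bigr => x _ /=; rewrite -?mulrnAr; field.
have -> : \sum_x w x * (\sum_u K x u * h x u) =
    \sum_x w x * ((\sum_u K x u * h x u) *+ G x) +
    \sum_x w x * ((\sum_u K x u * h x u) *+ ~~ G x).
  rewrite -big_split; apply: eq_bigr => x _ /=; rewrite -mulrDr.
  by case: (G x); rewrite ?mulr1n ?mulr0n ?addr0 ?add0r.
apply: (le_trans (lerD le (lexx _))); rewrite -addrA lerD2l -big_split /=.
apply: ler_sum => x _; rewrite -mulrDr ler_wpM2l // /G.
case: (leP (2 `^ k * _) 1) => _; rewrite ?mulr1n ?mulr0n ?addr0 ?add0r //.
rewrite -(fdist_sum1 (K x)); apply: ler_sum => u _.
by rewrite ler_piMr ?fdist_ge0 //; case/andP: (h01 x u).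
Qed.

(** The bound on [L] is required for every [Q] because conditioning on the first output changes the
    law of the dataset. *)
Lemma max_info_comp (U V : finType) (P : fdist R T) (K : T -> fdist R U)
    (L : T -> U -> fdist R V) (b1 k1 b2 k2 : R) :
  (max_info b1 (fdist_joint P K) <= k1%:E)%E ->
  (forall (u : U) (Q : fdist R T),
    (max_info b2 (fdist_joint Q (fun x => L x u)) <= k2%:E)%E) ->
  (max_info (b1 + b2) (fdist_joint P (fun x => fdist_joint (K x) (L x))) <=
    (k1 + k2)%:E)%E.
Proof.
move=> Kbk Lbk; apply/max_info_leP => h h01.
set M := (fun x => fdist_joint (K x) (L x)).
pose q := output_law P K.
(* The conditional law of the second output given the first. Where [q u] is 0 the quotient is 0,
   which is harmless since the pair then has mass 0 too. *)
pose r u v := output_law P M (u, v) / q u.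
have qE u : \sum_x P x * K x u = q u by rewrite /q output_lawE.
have q_ge0 u : 0 <= q u by exact: fdist_ge0.
have lawE u v : output_law P M (u, v) = \sum_x P x * K x u * L x u v.
  by rewrite output_lawE; apply: eq_bigr => x _; rewrite mulrA.
have rE u v : r u v * q u = output_law P M (u, v).
  rewrite /r; have [q0|q_neq0] := eqVneq (q u) 0; last by rewrite divfK.
  rewrite q0 mulr0 lawE big1 // => x _.
  move: q0; rewrite -qE => /psumr_eq0P ->; rewrite ?mul0r //.
  by move=> y _; rewrite mulr_ge0 ?fdist_ge0.
have r_ge0 u v : 0 <= r u v by rewrite divr_ge0 ?fdist_ge0.
pose f x u := \sum_v r u v * h x (u, v).
have f_ge0 x u : 0 <= f x u.
  by apply: sumr_ge0 => v _; rewrite mulr_ge0 //; case/andP: (h01 x (u, v)).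
pose g x u := Num.min 1 (2 `^ k2 * f x u).
have g01 x u : 0 <= g x u <= 1.
  by rewrite le_min ler01 mulr_ge0 ?powR_ge0 //= ge_min lexx.
have sum_pair (F : U * V -> R) : \sum_z F z = \sum_u \sum_v F (u, v).
  by rewrite pair_bigA /=; apply: eq_bigr => -[].
have -> : \sum_x P x * (\sum_z M x z * h x z) =
    \sum_u \sum_x P x * K x u * (\sum_v L x u v * h x (u, v)).
  rewrite exchange_big; apply: eq_bigr => x _; rewrite sum_pair mulr_sumr.
  apply: eq_bigr => u _; rewrite -mulrA mulr_sumr; congr (_ * _).
  by apply: eq_bigr => v _; rewrite mulrA.
(* For fixed [u] the weights [P x * K x u] sum to [q u], so the errors [b2 * q u] add up to [b2]. *)
apply: (@le_trans _ _ (\sum_u (b2 * q u + \sum_x P x * K x u * g x u))).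
  apply: ler_sum => u _; rewrite -qE.
  apply: (max_info_truncated (r := r u) (Lbk u)) => //.
  - by move=> x; rewrite mulr_ge0 ?fdist_ge0.
  - by move=> v; rewrite qE rE lawE.
rewrite big_split -mulr_sumr fdist_sum1 mulr1 /= exchange_big /=.
have -> : \sum_x \sum_u P x * K x u * g x u = \sum_x P x * \sum_u K x u * g x u.
  apply: eq_bigr => x _; rewrite mulr_sumr.
  by apply: eq_bigr => u _; rewrite mulrA.
have /max_info_leP/(_ g g01) := Kbk.
rewrite [b1 + b2]addrC -addrA lerD2l => /le_trans; apply.
rewrite lerD2l powRD ?pnatr_eq0 ?implybT // -mulrA ler_wpM2l ?powR_ge0 //.
rewrite mulr_sumr; apply: ler_sum => x _; rewrite mulrCA ler_wpM2l ?fdist_ge0 //.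
rewrite sum_pair mulr_sumr; apply: ler_sum => u _.
(* The truncation has served its purpose and is dropped; [q u * r u v] then recombines into the
   output law of the pair. *)
apply: (@le_trans _ _ (q u * (2 `^ k2 * f x u))).
  by rewrite ler_wpM2l // ge_min lexx orbT.
rewrite mulrCA ler_wpM2l ?powR_ge0 // mulr_sumr; apply: ler_sum => v _.
by rewrite mulrA [q u * _]mulrC rE.
Qed.

(** A test on the image pulls back along [f] to a test on [U], and pushing forward commutes with
    averaging over [P]. *)
Lemma max_info_map (U V : finType) (f : U -> V) (P : fdist R T)
    (K : T -> fdist R U) (b k : R) :
  (max_info b (fdist_joint P K) <= k%:E)%E ->
  (max_info b (fdist_joint P (fun x => fdist_map f (K x))) <= k%:E)%E.
Proof.
have mapE (Q : fdist R U) (h : V -> R) :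
    \sum_v fdist_map f Q v * h v = \sum_u Q u * h (f u).
  rewrite (partition_big f xpredT) //=; apply: eq_bigr => v _.
  by rewrite mulr_suml; apply: eq_bigr => u /eqP ->.
move=> /max_info_leP Kbk; apply/max_info_leP => h h01.
have := Kbk (fun x u => h x (f u)) (fun x u => h01 x (f u)).
congr (_ <= _ + _ * _); apply: eq_bigr => x _; rewrite -mapE //.
congr (_ * _); apply: eq_bigr => v _; congr (_ * _).
rewrite [RHS]output_lawE.
transitivity (\sum_(u | f u == v) \sum_y P y * K y u).
  by apply: eq_bigr => u _; exact: output_lawE.
by rewrite exchange_big; apply: eq_bigr => y _; rewrite -mulr_sumr.
Qed.

(** An output independent of the dataset has a joint law equal to the product of its marginals; the
    empty transcript is such an output. *)
Lemma max_info_const (P : fdist R T) (U : finType) (Q : fdist R U) :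
  (max_info 0 (fdist_joint P (fun=> Q)) <= 0%:E)%E.
Proof.
apply/max_info_leP => h _; rewrite add0r powRr0 mul1r.
apply: ler_sum => x _; apply: ler_wpM2l; first exact: fdist_ge0.
apply: ler_sum => u _; rewrite output_lawE -mulr_suml fdist_sum1 mul1r.
exact: lexx.
Qed.

End MaxInfo.

Lemma max_info_transcript (R : realType) (X : finType) (n m : nat)
    (Y : 'I_m -> finType) (A : adaptive_algorithms R X n Y) (beta k : 'I_m -> R)
    (hA : forall (i : nat) (ltim : (i < m)%N)
           (y : past_outputs Y (ltnW ltim)),
       has_approx_max_info (fun S => A i ltim S y)
         (beta (Ordinal ltim)) (k (Ordinal ltim)))
    (i : nat) (leim : (i <= m)%N) :
  has_approx_max_info (fun S => transcript A S leim)
    (\sum_(j < i) beta (widen_ord leim j)) (\sum_(j < i) k (widen_ord leim j)).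
Proof.
move=> P; elim: i leim => [|i IH] lim.
  by rewrite !big_ord0; exact: max_info_const.
have sumS (F : 'I_m -> R) : \sum_(j < i.+1) F (widen_ord lim j) =
    \sum_(j < i) F (widen_ord (ltnW lim) j) + F (Ordinal lim).
  rewrite big_ord_recr /=; congr (_ + F _); last exact: val_inj.
  by apply: eq_bigr => j _; congr F; exact: val_inj.
(* Once the past outputs [y] are fixed, the next algorithm is a map of the dataset alone, to which
   [hA] applies under any law [Q]. *)
rewrite !sumS; apply: (max_info_comp (IH (ltnW lim))) => y Q.
exact: hA.
Qed.

Theorem theorem15 (R : realType) (X : finType) (n m : nat)
    (Y : 'I_m.+1 -> finType) (A : adaptive_algorithms R X n Y)
    (beta k : 'I_m.+1 -> R)
    (hA : forall (i : nat) (ltim : (i < m.+1)%N)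
           (y : past_outputs Y (ltnW ltim)),
       has_approx_max_info (fun S => A i ltim S y)
         (beta (Ordinal ltim)) (k (Ordinal ltim))) :
  has_approx_max_info (adaptive_composition A)
    (\sum_(i < m.+1) beta i) (\sum_(i < m.+1) k i).
Proof.
move=> P; apply: max_info_map; have := max_info_transcript hA (ltnSn m) P.
have widenE (F : 'I_m.+1 -> R) :
    \sum_(j < m.+1) F (widen_ord (ltnSn m) j) = \sum_(j < m.+1) F j.
  by apply: eq_bigr => j _; congr F; exact: val_inj.
by rewrite !widenE.
Qed.
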